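(* Let $n$ be a positive integer and let $A\in\mathbb R^{n\times n}$ be a constant matrix all of whose eigenvalues $\lambda_1,\dots,\lambda_p$ have nonzero real parts, with $\operatorname{Re}\lambda_i<0$ for $i=1,\dots,q$ and $\operatorname{Re}\lambda_i>0$ for $i=q+1,\dots,p$, where $1\le q<p$. Let $B\in\mathbb R^{n\times n}$ be a regular (invertible) matrix such that $B^{-1}AB=\operatorname{diag}(A_-,A_+)$ is block diagonal, where all eigenvalues of $A_-$ have negative real parts and all eigenvalues of $A_+$ have positive real parts. Let $g:\mathbb R\to\mathbb R^n$ be an unpredictable function. Then the function $f(t)=B^{-1}g(t)$ is unpredictable.
   Context: $\|\cdot\|$ denotes the Euclidean norm for vectors. A uniformly continuous and bounded function $\vartheta:\mathbb R\to\mathbb R^m$ is called unpredictable if there exist positive numbers $\epsilon_0,\delta$ and sequences $\{t_n\},\{u_n\}$ of real numbers, both of which diverge to infinity, such that (i) $\|\vartheta(t+t_n)-\vartheta(t)\|\to 0$ as $n\to\infty$ uniformly on compact subsets of $\mathbb R$, and (ii) $\|\vartheta(t+t_n)-\vartheta(t)\|\ge\epsilon_0$ for each $t\in[u_n-\delta,u_n+\delta]$ and each $n\in\mathbb N$. The matrix $B$ is the one for which the substitution $x=By$ transforms the system $x'(t)=Ax(t)+g(t)$ into $y'(t)=B^{-1}ABy(t)+B^{-1}g(t)$ with block diagonal coefficient matrix. *)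

(* Defs.v *)
From HB Require Import structures.
From mathcomp Require Import all_boot all_order all_algebra.
From mathcomp Require Import all_classical all_reals all_analysis.
From mathcomp Require Import complex.
Set Implicit Arguments.
Unset Strict Implicit.
Unset Printing Implicit Defensive.
Import Order.TTheory GRing.Theory Num.Theory.
Import numFieldNormedType.Exports.
Local Open Scope classical_set_scope.
Local Open Scope ring_scope.

(* Euclidean norm on R^m; the library norm `|x| on matrices is the sup norm. *)
Definition enorm (R : realType) (m : nat) (x : 'cV[R]_m) : R :=
  Num.sqrt (\sum_(i < m) x i 0 ^+ 2).

(* [unif_continuous] refers to the product uniformity of 'cV[R]_m, which is
   also the one induced by [enorm]. *)
Definition unpredictable (R : realType) (m : nat) (theta : R -> 'cV[R]_m) :
    Prop :=
  [/\ unif_continuous theta,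
      bounded_fun (fun t : R => enorm (theta t)) &
      exists (eps0 delta : R) (t_ u_ : nat -> R),
        [/\ 0 < eps0 /\ 0 < delta,
            t_ n @[n --> \oo] --> +oo,
            u_ n @[n --> \oo] --> +oo,
            forall K : set R, compact K ->
              {uniform K, (fun (n : nat) (t : R) =>
                enorm (theta (t + t_ n) - theta t)) @ \oo --> (fun=> 0 : R)} &
            forall (n : nat) (t : R), t \in `[u_ n - delta, u_ n + delta] ->
              eps0 <= enorm (theta (t + t_ n) - theta t)]].

Definition complex_eigenvalue (R : realType) (n : nat) (A : 'M[R]_n)
    (z : R[i]) : Prop :=
  eigenvalue (map_mx (real_complex R) A) z.

(* Main.v *)
Require Import Defs.
From mathcomp Require Import all_boot all_order all_algebra.
From mathcomp Require Import all_classical all_reals all_analysis.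
From mathcomp Require Import complex.
Import Order.TTheory GRing.Theory Num.Theory.
Local Open Scope ring_scope.
Import numFieldNormedType.Exports.
Local Open Scope classical_set_scope.
Local Open Scope ring_scope.
Set Implicit Arguments.
Unset Strict Implicit.
Unset Printing Implicit Defensive.

(** Unpredictability survives every injective linear map, and [invmx B] is one,
    with left inverse [B].  If [N *m M = 1%:M], the map [M] sends the
    displacement [theta (t + t_n) - theta t] to the displacement of
    [M *m theta], and boundedness of [M] and of [N] makes the Euclidean norms of
    the two comparable with constants independent of [t] and [n].  The upper
    bound ([enorm_mulmx_le] for [M]) transports boundedness and uniform
    convergence along [t_n] on compact sets; the lower bound (the same lemma for
    [N]) transports separation near [u_n], with [eps0] divided by the bound of
    [N].  Uniform continuity is that of [theta] followed by that of the linear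
    map ([mulmx_unif_continuous]).  The sequences [t_n], [u_n] and the radius
    [delta] are unchanged. *)

Lemma enorm_ge0 (R : realType) (m : nat) (x : 'cV[R]_m) : 0 <= enorm x.
Proof. exact: sqrtr_ge0. Qed.

Lemma le_enorm_entry (R : realType) (m : nat) (x : 'cV[R]_m) (i : 'I_m) :
  `|x i 0| <= enorm x.
Proof.
rewrite -sqrtr_sqr ler_wsqrtr// (bigD1 i)//= lerDl.
by apply: sumr_ge0 => j _; exact: sqr_ge0.
Qed.

Lemma enorm_le_sum (R : realType) (m : nat) (x : 'cV[R]_m) :
  enorm x <= \sum_i `|x i 0|.
Proof.
have s0 : 0 <= \sum_i `|x i 0| by apply: sumr_ge0.
rewrite -[leRHS]ger0_norm// -sqrtr_sqr ler_wsqrtr//.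
rewrite [leRHS]expr2 mulr_suml ler_sum// => i _.
rewrite -real_normK ?num_real// expr2 ler_wpM2l//.
by rewrite (bigD1 i)//= lerDl; apply: sumr_ge0.
Qed.

(** The summand [1] makes this bound positive, so that it can be divided by. *)
Definition mxbound (R : realType) (m n : nat) (M : 'M[R]_(m, n)) : R :=
  1 + \sum_i \sum_j `|M i j|.

Lemma mxbound_gt0 (R : realType) (m n : nat) (M : 'M[R]_(m, n)) :
  0 < mxbound M.
Proof. by rewrite ltr_pwDl//; do 2!(apply: sumr_ge0 => ? _). Qed.

(** Measuring the input in the sup norm and the output in the l1 norm serves
    both norms in use: the Euclidean one lies between these two, and the product
    uniformity is that of the sup norm. *)
Lemma sum_mulmx_le (R : realType) (m n : nat) (M : 'M[R]_(m, n))
    (x : 'cV[R]_n) (r : R) : 0 <= r -> (forall j, `|x j 0| <= r) ->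
  \sum_i `|(M *m x) i 0| <= mxbound M * r.
Proof.
move=> r0 xr; rewrite mulrDl mul1r ler_wpDl// mulr_suml ler_sum// => i _.
rewrite mxE (le_trans (ler_norm_sum _ _ _))// mulr_suml ler_sum// => j _.
by rewrite normrM ler_wpM2l.
Qed.

Lemma enorm_mulmx_le (R : realType) (m n : nat) (M : 'M[R]_(m, n))
    (x : 'cV[R]_n) : enorm (M *m x) <= mxbound M * enorm x.
Proof.
apply: le_trans (enorm_le_sum _) _; apply: sum_mulmx_le; first exact: enorm_ge0.
exact: le_enorm_entry.
Qed.

Lemma mulmx_unif_continuous (R : realType) (m n : nat) (M : 'M[R]_(m, n)) :
  unif_continuous (mulmx M : 'cV[R]_n -> 'cV[R]_m).
Proof.
apply/unif_continuousP => e e0; have M0 := mxbound_gt0 M.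
have d0 : 0 < e / 2 / mxbound M by rewrite !divr_gt0.
(* The factor 2 turns the weak bound of sum_mulmx_le into a strict one. *)
exists (e / 2 / mxbound M) => // -[x y] /= [_ xy]; split=> // i j.
have {}xy k : `|(x - y) k 0| <= e / 2 / mxbound M.
  by have := xy k 0; rewrite !mxE => /ltW.
rewrite (ord1 j) /ball/=.
have -> : (M *m x) i 0 - (M *m y) i 0 = (M *m (x - y)) i 0.
  by rewrite mulmxBr !mxE.
apply: (@le_lt_trans _ _ (e / 2)); last by rewrite gtr_pMr// invf_lt1// ltr1n.
have := sum_mulmx_le M (ltW d0) xy; rewrite mulrC divfK ?gt_eqF//.
by apply: le_trans; rewrite (bigD1 i)//= lerDl; apply: sumr_ge0.
Qed.

(** Reduces condition (i) of unpredictability to estimates between norms. *)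
Lemma cvg_uniform_normP (R : realType) (K : set R) (F : nat -> R -> R)
    (f : R -> R) :
  {uniform K, F @ \oo --> f} <->
  forall e, 0 < e -> \forall n \near \oo, forall t, K t -> `|f t - F n t| < e.
Proof.
split=> [Ff _/posnumP[e]|Ff P /uniform_nbhs[E [entE EP]]].
  apply: (Ff [set h | forall t, K t -> ball (f t) e%:num (h t)]).
  apply/uniform_nbhs.
  by exists [set xy | ball xy.1 e%:num xy.2]; split=> //; exact: entourage_ball.
move: entE; rewrite -entourage_ballE => -[e /= e0 eE].
have := Ff e e0; rewrite /nbhs/= /fmap/=.
by apply: filterS => n Hn; apply: EP => t Kt; apply: eE; exact: Hn.
Qed.

(** The left inverse expresses injectivity of [M] in the quantitative form that
    the separation condition needs. *)
Lemma unpredictable_mulmx (R : realType) (m n : nat) (M : 'M[R]_(m, n))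
    (N : 'M[R]_(n, m)) (theta : R -> 'cV[R]_n) :
  N *m M = 1%:M -> unpredictable theta ->
  unpredictable (fun t => M *m theta t).
Proof.
move=> NM [cth bth [eps0 [delta [t_ [u_ [[e0 d0] t_oo u_oo t_cvg u_sep]]]]]].
have M0 := mxbound_gt0 M; have N0 := mxbound_gt0 N.
split.
- exact: (cvg_comp _ _ cth (mulmx_unif_continuous M)).
- have PF : ProperFilter (globally [set: R]).
    exact: (@globally_properfilter R setT 0 I).
  have /(ex_bound _)[c cP] := bth.
  apply/(ex_bound _); exists (mxbound M * c) => t _.
  rewrite /= ger0_norm ?enorm_ge0// (le_trans (enorm_mulmx_le _ _))//.
  rewrite ler_pM2l//.
  by have := cP t I; rewrite /= ger0_norm// enorm_ge0.
exists (eps0 / mxbound N), delta, t_, u_; split => //.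
- by rewrite divr_gt0.
- move=> K cK; apply/cvg_uniform_normP => e egt0.
  have /cvg_uniform_normP/(_ (e / mxbound M)) := t_cvg K cK.
  rewrite divr_gt0// => /(_ isT); apply: filterS => k Hk t /Hk.
  rewrite !sub0r !normrN !ger0_norm ?enorm_ge0// ltr_pdivlMr// mulrC -mulmxBr.
  exact/le_lt_trans/enorm_mulmx_le.
- move=> k t /u_sep; rewrite ler_pdivrMr// mulrC -mulmxBr => /le_trans; apply.
  by rewrite -{1}[theta _ - _]mul1mx -NM -mulmxA; exact: enorm_mulmx_le.
Qed.

Theorem lemma1p1 (R : realType) (n : nat) (hn : (0 < n)%N) (A : 'M[R]_n)
    (p q : nat) (lambda : 'I_p -> R[i])
    (hlambda : forall z : R[i],
        complex_eigenvalue A z <-> exists i : 'I_p, z = lambda i)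
    (hre : forall i : 'I_p, complex.Re (lambda i) != 0)
    (hq : (1 <= q < p)%N)
    (hneg : forall i : 'I_p, (i < q)%N -> complex.Re (lambda i) < 0)
    (hpos : forall i : 'I_p, (q <= i)%N -> 0 < complex.Re (lambda i))
    (B : 'M[R]_n) (hB : B \in unitmx)
    (k l : nat) (hkl : (k + l)%N = n) (Am : 'M[R]_k) (Ap : 'M[R]_l)
    (hdiag : invmx B *m A *m B = castmx (hkl, hkl) (block_mx Am 0 0 Ap))
    (hAm : forall z : R[i], complex_eigenvalue Am z -> complex.Re z < 0)
    (hAp : forall z : R[i], complex_eigenvalue Ap z -> 0 < complex.Re z)
    (g : R -> 'cV[R]_n) (hg : unpredictable g) :
  unpredictable (fun t : R => invmx B *m g t).
Proof. exact: (unpredictable_mulmx (mulmxV hB) hg). Qed.
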